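(* The $\mathrm{GL}(3)$ tensor product algebra $\mathrm{TA}(3)$ is generated as a $\mathbb{C}$-algebra by \begin{align*} &g_1=\Delta_0(1),\quad g_2=\Delta_0(1,2,3),\quad g_3=\Delta_0(1,2),\quad g_4=\Delta_1(\,),\quad g_5=\Delta_1(1),\\ &g_6=\Delta_1(1,2),\quad g_7=\Delta_2(\,),\quad g_8=\Delta_2(1),\quad g_9=\Delta_3(\,),\\ &g_{10}=\Delta_2(2)\,\Delta_0(1)-\Delta_2(1)\,\Delta_0(2), \end{align*} and there is one basic relation $g_1g_6g_7-g_5g_{10}+g_3g_4g_8=0$ among them (that is, the ideal of all polynomial relations among $g_1,\ldots,g_{10}$ is generated by this one). Therefore \[ \mathrm{TA}(3)\cong\mathbb{C}[z_1,z_2,\ldots,z_{10}]/\langle z_1z_6z_7-z_5z_{10}+z_3z_4z_8\rangle . \] Here $\Delta_i(j_1,\ldots,j_k)$ denotes the minor defined in the context, with $n=3$.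
   Context: Let $M_n$ be the space of $n\times n$ complex matrices. On $M_n\oplus M_n$ use coordinates $(x_{ij})$ on the first summand and $(y_{ij})$ on the second, so that $\mathbb{C}[M_n\oplus M_n]=\mathbb{C}[x_{ij},y_{ij}:1\le i,j\le n]$. The group $\mathrm{GL}(n)^3$, with $\mathrm{GL}(n)=\mathrm{GL}_n(\mathbb{C})$, acts on $\mathbb{C}[M_n\oplus M_n]$ by \[ (g\cdot f)(m_1,m_2)=f(g_1^tm_1g_2,\;g_1^tm_2g_3),\qquad g=(g_1,g_2,g_3). \] Let $U_n\subset\mathrm{GL}(n)$ be the subgroup of upper triangular matrices with $1$'s on the diagonal. The $\mathrm{GL}(n)$ tensor product algebra is the invariant algebra \[ \mathrm{TA}(n)=\mathbb{C}[M_n\oplus M_n]^{U_n\times U_n\times U_n}. \] Minors: consider the $n\times 2n$ matrix $[\,x\,|\,y\,]$ whose first $n$ columns are those of $(x_{ij})$ and whose last $n$ columns are those of $(y_{ij})$. For $i\ge0$ and $1\le j_1<\cdots<j_k\le n$ (with $k\ge 0$ and $1\le i+k\le n$), $\Delta_i(j_1,\ldots,j_k)$ denotes the determinant of the $(i+k)\times(i+k)$ submatrix with rows $1,2,\ldots,i+k$ and columns $1,2,\ldots,i,n+j_1,\ldots,n+j_k$. (In the paper this determinant is denoted by the one-column tableau having $i$ empty boxes followed by boxes with entries $j_1,\ldots,j_k$.) For $k=0$ we write $\Delta_i(\,)$. *)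

(* Defs.v *)
From HB Require Import structures.
From mathcomp Require Import all_boot all_order all_algebra.
From mathcomp Require Import generic_quotient ring_quotient.
From mathcomp Require Import boolp reals complex mpoly.

Set Implicit Arguments.
Unset Strict Implicit.
Unset Printing Implicit Defensive.

Import GRing.Theory.
Local Open Scope ring_scope.
Local Open Scope quotient_scope.

(* ring_quotient only makes {ideal_quot I} a ring.                            *)
Section IdealQuotientAlgebra.
Variables (K : comNzRingType) (A : comAlgType K) (I : idealr A).
Local Notation Q := {ideal_quot I}.

Definition ideal_quot_scale (c : K) (x : Q) : Q := \pi_Q (c *: 1) * x.

Let scaleA a b (v : Q) :
  ideal_quot_scale a (ideal_quot_scale b v) = ideal_quot_scale (a * b) v.
Proof.
by rewrite /ideal_quot_scale mulrA -rmorphM /= -scalerAl mul1r scalerA.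
Qed.

Let scale1 : left_id 1 ideal_quot_scale.
Proof. by move=> v; rewrite /ideal_quot_scale scale1r rmorph1 mul1r. Qed.

Let scaleDr : right_distributive ideal_quot_scale +%R.
Proof. by move=> a u v; rewrite /ideal_quot_scale mulrDr. Qed.

Let scaleDl v : {morph ideal_quot_scale^~ v : a b / a + b}.
Proof.
by move=> a b; rewrite /ideal_quot_scale scalerDl rmorphD mulrDl.
Qed.

HB.instance Definition _ :=
  GRing.Zmodule_isLmodule.Build K Q scaleA scale1 scaleDr scaleDl.

Let scaleAl (a : K) (u v : Q) : a *: (u * v) = (a *: u) * v.
Proof. exact: mulrA. Qed.

HB.instance Definition _ := GRing.Lmodule_isLalgebra.Build K Q scaleAl.
HB.instance Definition _ := GRing.Lalgebra_isComAlgebra.Build K Q.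

Lemma pi_ideal_quotZ (c : K) (a : A) : \pi_Q (c *: a) = c *: \pi_Q a.
Proof. by rewrite -[a in LHS]mul1r scalerAl rmorphM. Qed.

End IdealQuotientAlgebra.

Definition principal_ideal (A : comNzRingType) (r : A) : {pred A} :=
  fun p => `[< exists q, p = q * r >].

Definition unitriangular (K : fieldType) (n : nat) (u : 'M[K]_n) : Prop :=
  (forall i, u i i = 1) /\ (forall i j : 'I_n, (j < i)%N -> u i j = 0).

Lemma unitriangular_unitmx (K : fieldType) (n : nat) (u : 'M[K]_n) :
  unitriangular u -> u \in unitmx.
Proof.
move=> [u1 u0]; rewrite unitmxE -det_tr det_trig.
  by rewrite big1 ?unitr1 // => i _; rewrite mxE.
by apply/is_trig_mxP => i j ij; rewrite mxE u0.
Qed.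

Section TensorProductAlgebra.
Variables (K : fieldType) (n : nat).

(* The variables of {mpoly K[n * n + n * n]} are the entries of a pair of     *)
(* n x n matrices, the first matrix coming first, in the order of mxvec.      *)
Definition pair_coords (S : Type) (m1 m2 : 'M[S]_n) : (n * n + n * n).-tuple S :=
  [tuple row_mx (mxvec m1) (mxvec m2) 0 i | i < n * n + n * n].

Local Notation P := {mpoly K[n * n + n * n]}.

Definition xmx : 'M[P]_n := \matrix_(i, j) 'X_(lshift (n * n) (mxvec_index i j)).
Definition ymx : 'M[P]_n := \matrix_(i, j) 'X_(rshift (n * n) (mxvec_index i j)).

(* Only meant for invertible g1, g2, g3. *)
Definition act (g1 g2 g3 : 'M[K]_n) (f : P) : P :=
  let c (g : 'M[K]_n) : 'M[P]_n := map_mx (@mpolyC _ K) g in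
  f \mPo pair_coords ((c g1)^T *m xmx *m c g2) ((c g1)^T *m ymx *m c g3).

Lemma act_eval (g1 g2 g3 : 'M[K]_n) (f : P) (m1 m2 : 'M[K]_n) :
  (act g1 g2 g3 f).@[tnth (pair_coords m1 m2)] =
  f.@[tnth (pair_coords (g1^T *m m1 *m g2) (g1^T *m m2 *m g3))].
Proof.
have ev (w : 'M[P]_n) (m a b : 'M[K]_n) :
    (forall i j, (w i j).@[tnth (pair_coords m1 m2)] = m i j) ->
    forall i j, (((map_mx (@mpolyC _ K) a)^T *m w *m map_mx (@mpolyC _ K) b) i j)
      .@[tnth (pair_coords m1 m2)] = (a^T *m m *m b) i j.
  move=> wm i j; rewrite !mxE rmorph_sum; apply: eq_bigr => k _.
  rewrite rmorphM !mxE rmorph_sum /= mevalC; congr (_ * _).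
  by apply: eq_bigr => l _; rewrite rmorphM !mxE /= mevalC wm.
rewrite /act comp_mpoly_meval; apply: meval_eq => k; rewrite !tnth_mktuple.
case: (splitP k) => l kl; have := kl.
  have -> : k = lshift _ l by apply: val_inj.
  rewrite !row_mxEl; case/mxvec_indexP: l {kl} => i j _; rewrite !mxvecE.
  apply: ev => {}i {}j.
  by rewrite mxE mevalXU tnth_mktuple row_mxEl mxvecE.
have -> : k = rshift _ l by apply: val_inj.
rewrite !row_mxEr; case/mxvec_indexP: l {kl} => i j _; rewrite !mxvecE.
apply: ev => {}i {}j.
by rewrite mxE mevalXU tnth_mktuple row_mxEr mxvecE.
Qed.

Definition TA : {pred P} := fun f =>
  `[< forall u1 u2 u3 : 'M[K]_n, unitriangular u1 -> unitriangular u2 ->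
        unitriangular u3 -> act u1 u2 u3 f = f >].

Lemma TA_subalg_closed : subalg_closed TA.
Proof.
split=> [|c f g /asboolP fI /asboolP gI|f g /asboolP fI /asboolP gI];
  apply/asboolP => u1 u2 u3 U1 U2 U3; rewrite /act.
- by rewrite rmorph1.
- by rewrite linearP /= -/(act u1 u2 u3 f) -/(act u1 u2 u3 g) fI ?gI.
- by rewrite rmorphM /= -/(act u1 u2 u3 f) -/(act u1 u2 u3 g) fI ?gI.
Qed.

HB.instance Definition _ := GRing.isSubalgClosed.Build K P TA TA_subalg_closed.

Record TA_alg := TAElem { TA_val : P; _ : TA_val \in TA }.

HB.instance Definition _ := [isSub for TA_val].
HB.instance Definition _ := [Choice of TA_alg by <:].
HB.instance Definition _ := [SubChoice_isSubAlgebra of TA_alg by <:].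

Let TA_mulrC : commutative (@GRing.mul TA_alg).
Proof. by move=> f g; apply: val_inj; rewrite !rmorphM /= mulrC. Qed.

HB.instance Definition _ := GRing.PzRing_hasCommutativeMul.Build TA_alg TA_mulrC.

(* Columns 1..i of x followed by the columns j_1, ..., j_k of y; the indices  *)
(* j_l : 'I_n are counted from 0.                                             *)
Definition minor_col (i k : nat) (js : k.-tuple 'I_n) (ik : (i + k <= n)%N)
    (b : 'I_(i + k)) : 'I_(n + n) :=
  match split b with
  | inl a => lshift n (widen_ord (leq_trans (leq_addr k i) ik) a)
  | inr l => rshift n (tnth js l)
  end.

Definition minor (i k : nat) (js : k.-tuple 'I_n) (ik : (i + k <= n)%N) : P :=
  \det (mxsub (widen_ord ik) (minor_col js ik) (row_mx xmx ymx)).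

End TensorProductAlgebra.

Arguments TA : clear implicits.
Arguments TA_alg : clear implicits.

Section TA3.
Variable K : fieldType.

Local Notation P := {mpoly K[3 * 3 + 3 * 3]}.
Local Notation "''Delta_' i js" := (@minor K 3 i _ js isT)
  (at level 8, i at level 2, js at level 1).

Let j1 : 'I_3 := @Ordinal 3 0 isT.
Let j2 : 'I_3 := @Ordinal 3 1 isT.
Let j3 : 'I_3 := @Ordinal 3 2 isT.

Definition TA3_gens : 10.-tuple P :=
  [tuple 'Delta_0 [tuple j1];
         'Delta_0 [tuple j1; j2; j3];
         'Delta_0 [tuple j1; j2];
         'Delta_1 [tuple];
         'Delta_1 [tuple j1];
         'Delta_1 [tuple j1; j2];
         'Delta_2 [tuple];
         'Delta_2 [tuple j1];
         'Delta_3 [tuple];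
         'Delta_2 [tuple j2] * 'Delta_0 [tuple j1]
           - 'Delta_2 [tuple j1] * 'Delta_0 [tuple j2]].

(* z_k, counted from 1 *)
Let z (k : nat) : {mpoly K[10]} := 'X_(inord k.-1).

Definition TA3_relation : {mpoly K[10]} :=
  z 1 * z 6 * z 7 - z 5 * z 10 + z 3 * z 4 * z 8.

Definition TA3_ideal : {pred {mpoly K[10]}} := principal_ideal TA3_relation.

Lemma TA3_idealr_closed : idealr_closed TA3_ideal.
Proof.
split.
- by apply/asboolP; exists 0; rewrite mul0r.
- apply/asboolP => -[q /(congr1 (meval (fun=> 0)))].
  rewrite meval1 mevalM /TA3_relation mevalD mevalB !mevalM !mevalXU.
  by rewrite !mul0r subrr addr0 mulr0 => /eqP; rewrite oner_eq0.
- move=> a _ _ /asboolP[p ->] /asboolP[q ->]; apply/asboolP.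
  by exists (a * p + q); rewrite mulrDl mulrA.
Qed.

HB.instance Definition _ := isIdealr.Build {mpoly K[10]} TA3_ideal TA3_idealr_closed.

End TA3.

Arguments TA3_ideal : clear implicits.

(* Main.v *)
Require Import Defs.
From HB Require Import structures.
From mathcomp Require Import all_boot all_order all_algebra.
From mathcomp Require Import generic_quotient ring_quotient.
From mathcomp Require Import boolp reals complex mpoly.
From mathcomp Require Import ring.

Set Implicit Arguments.
Unset Strict Implicit.
Unset Printing Implicit Defensive.

Import GRing.Theory Num.Theory.
Local Open Scope ring_scope.

(** The 18 variables are the entries of a pair [(x, y)] of 3 x 3 matrices, and
    [gval x y] lists the values at it of g1, ..., g10.  Coefficients lie in an
    infinite field, so all identities between polynomials may be checked on
    values.

    If g1, g3, g4 and g7 do not vanish at [(x, y)], Gaussian elimination by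
    unitriangular matrices makes [x] diagonal and [y] lower triangular
    ([diagonal_form], [lower_triangular_form]), and the entries of this normal
    form are quotients of the values g1, ..., g10, with denominators that are
    products of g1, g3, g4 and g7 ([normal_gval]).  So for every invariant [f]
    some (g1 g3 g4 g7)^N f is a polynomial in the generators.

    It remains to cancel the factors g1, g3, g4, g7 one at a time: if
    g_i f = p(g1, ..., g10), then [p] lies in the ideal (r, z_i), where [r] is
    the basic relation ([gens_comp_divides]).  Indeed [p] vanishes at every
    value of (g1, ..., g10) having g_i = 0.  An explicit pair of matrices shows
    that every point with r = 0, z_i = 0 and all other coordinates nonzero is
    such a value ([section_at]).  On z_i = 0, for these four indices, r becomes
    h - z5 z10 with [h] a monomial free of z5 and z10, and a polynomial that
    vanishes at the points of z5 z10 = h with nonzero coordinates is a multiple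
    of z5 z10 - h: some z5^N p is congruent to a polynomial without z10, which
    must be 0, and z5 is then cancelled ([hypersurface_nullstellensatz]).

    The same two facts, with no coordinate set to 0, give the ideal of
    relations: the generators reach every point of r = 0 at which z1, z3, z4
    and z7 do not vanish ([gval_normal]), so a relation is a multiple of [r].
    The isomorphism is a formal consequence. *)

(** * Multivariate polynomials *)

(** Induction along the algebra operations instead of monomials. *)
Lemma mpoly_alg_ind (n : nat) (R : comNzRingType) (P : {mpoly R[n]} -> Prop) :
  (forall c, P c%:MP) -> (forall i, P 'X_i) ->
  (forall p q, P p -> P q -> P (p + q)) ->
  (forall p q, P p -> P q -> P (p * q)) -> forall p, P p.
Proof.
move=> PC PX PD PM; elim/mpolyind=> [|c m p _ _ Pp]; first by rewrite -mpolyC0.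
apply: PD Pp; rewrite -mul_mpolyC; apply: (PM) => //; rewrite mpolyXE_id.
apply: big_ind => [|//|i _]; first by rewrite -mpolyC1.
by elim: (m i) => [|k IH]; [rewrite expr0 -mpolyC1 | rewrite exprS; apply: PM].
Qed.

Lemma mwiden_meval (n : nat) (R : comNzRingType) (p : {mpoly R[n]})
    (v : 'I_n.+1 -> R) :
  (mwiden p).@[v] = p.@[v \o widen_ord (leqnSn n)].
Proof.
elim/mpoly_alg_ind: p => [c|i|p q hp hq|p q hp hq].
- by rewrite mwidenC !mevalC.
- by rewrite mwidenX mnmwiden1 !mevalXU.
- by rewrite raddfD /= !mevalD hp hq.
- by rewrite mwidenM !mevalM hp hq.
Qed.

(** Every polynomial is a polynomial in its last variable. *)
Lemma mpoly_last_var (n : nat) (R : comNzRingType) (p : {mpoly R[n.+1]}) :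
  exists q : {poly {mpoly R[n]}}, p = (map_poly (@mwiden n R) q).['X_ord_max].
Proof.
elim/mpoly_alg_ind: p => [c|i|p q [p' ->] [q' ->]|p q [p' ->] [q' ->]].
- by exists (c%:MP)%:P; rewrite map_polyC hornerC /= mwidenC.
- have [j|] := unliftP ord_max i => ->; last first.
    by exists 'X; rewrite map_polyX hornerX.
  exists ('X_j)%:P; rewrite map_polyC hornerC /= mwidenX mnmwiden1.
  by congr 'X_[U_(_)]; apply: val_inj; rewrite /= /bump leqNgt ltn_ord.
- by exists (p' + q'); rewrite rmorphD hornerD.
- by exists (p' * q'); rewrite rmorphM hornerM.
Qed.

(** The field of coefficients being infinite, polynomials may be identified
    with polynomial functions. *)
Lemma mpoly_fun_eq0 (K : numFieldType) (n : nat) (p : {mpoly K[n]}) :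
  (forall v, p.@[v] = 0) -> p = 0.
Proof.
elim: n p => [|n IH] p p0.
  move: p0; rewrite (nvar0_mpolyC_eq p erefl) => p0.
  by have := p0 (fun=> 0); rewrite mevalC => ->; rewrite mpolyC0.
have [q def_p] := mpoly_last_var p.
suff q0 : q = 0 by rewrite def_p q0 rmorph0 horner0.
apply/polyP => k; rewrite coef0; apply: IH => w.
have -> : (q`_k).@[w] = (map_poly (meval w) q)`_k by rewrite coef_map.
suff -> : map_poly (meval w) q = 0 by rewrite coef0.
set q1 := map_poly _ _.
have root_q1 (t : K) : root q1 t.
  pose v i := if unlift ord_max i is Some j then w j else t.
  apply/rootP; rewrite -[RHS](p0 v) def_p.
  have vE : v \o widen_ord (leqnSn n) =1 w.
    move=> j; rewrite /v /=; have -> : widen_ord (leqnSn n) j = lift ord_max j.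
      by apply: val_inj; rewrite /= /bump leqNgt ltn_ord.
    by rewrite liftK.
  rewrite -horner_map /= mevalXU /v unlift_none -map_poly_comp.
  congr (_.[_]); apply: eq_map_poly => r /=.
  by rewrite mwiden_meval (meval_eq _ vE).
(* The scalars 0, 1, 2, and so on are size q1 distinct roots of q1. *)
apply: (@roots_geq_poly_eq0 _ _ [seq i%:R | i <- iota 0 (size q1)]).
- by apply/allP => t _.
- by rewrite map_inj_uniq ?iota_uniq // => i j /eqP; rewrite eqr_nat => /eqP.
- by rewrite size_map size_iota.
Qed.

Lemma mpoly_fun_inj (K : numFieldType) (n : nat) (p q : {mpoly K[n]}) :
  (forall v, p.@[v] = q.@[v]) -> p = q.
Proof.
move=> pq; apply/eqP; rewrite -subr_eq0; apply/eqP/mpoly_fun_eq0 => v.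
by rewrite mevalB pq subrr.
Qed.

(** Substitution of [0] for the variable ['X_j]. *)
Definition kill (n : nat) (R : comNzRingType) (j : 'I_n) (p : {mpoly R[n]}) :
    {mpoly R[n]} :=
  p \mPo [tuple if i == j then 0 else 'X_i | i < n].

Section Kill.
Variables (n : nat) (K : numFieldType).
Implicit Types (p q h : {mpoly K[n]}) (i j k : 'I_n) (v w : 'I_n -> K).

Lemma kill_meval j p v :
  (kill j p).@[v] = p.@[fun i => if i == j then 0 else v i].
Proof.
rewrite comp_mpoly_meval; apply: meval_eq => i.
by rewrite tnth_mktuple; case: eqP => _; rewrite ?meval0 ?mevalXU.
Qed.

Lemma killXU j i : kill j 'X_i = (if i == j then 0 else 'X_i) :> {mpoly K[n]}.
Proof.
apply: mpoly_fun_inj => v; rewrite kill_meval mevalXU.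
by case: eqP => _; rewrite ?meval0 ?mevalXU.
Qed.

Lemma killD j p q : kill j (p + q) = kill j p + kill j q.
Proof. exact: rmorphD. Qed.

Lemma killM j p q : kill j (p * q) = kill j p * kill j q.
Proof. exact: rmorphM. Qed.

Lemma killN j p : kill j (- p) = - kill j p.
Proof. exact: rmorphN. Qed.

Lemma mpolyXU_neq0 j : 'X_j != 0 :> {mpoly K[n]}.
Proof.
apply/eqP => /(congr1 (meval (fun=> 1))); rewrite mevalXU meval0 => /eqP.
by rewrite oner_eq0.
Qed.

(** [p] and [kill j p] are congruent modulo ['X_j]. *)
Lemma kill_subP j p : exists a, p = kill j p + a * 'X_j.
Proof.
elim/mpoly_alg_ind: p => [c|i|p q [a ha] [b hb]|p q [a ha] [b hb]].
- by exists 0; rewrite mul0r addr0 /kill comp_mpolyC.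
- rewrite killXU; case: eqP => [->|_]; last by exists 0; rewrite mul0r addr0.
  by exists 1; rewrite mul1r add0r.
- exists (a + b); rewrite {1}ha {1}hb killD; ring.
- exists (kill j p * b + a * kill j q + a * b * 'X_j).
  rewrite {1}ha {1}hb killM; ring.
Qed.

Lemma kill_eq0 j p : kill j p = 0 -> exists a, p = a * 'X_j.
Proof. by move=> p0; have [a] := kill_subP j p; rewrite p0 add0r; exists a. Qed.

(** [kill j p = p] says that ['X_j] does not occur in [p]; then the value of
    [p] does not depend on the coordinate of index [j]. *)
Lemma kill_indep j p v w : kill j p = p ->
  (forall i, i != j -> v i = w i) -> p.@[v] = p.@[w].
Proof.
move=> <- vw; rewrite !kill_meval; apply: meval_eq => i.
by case: ifPn => // /vw.
Qed.

(** The hypersurface ['X_j * 'X_k = h], where [h] is free of ['X_j] and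
    ['X_k]. *)
Section Hypersurface.
Variables (j k : 'I_n) (h : {mpoly K[n]}).
Hypotheses (njk : j != k) (hj : kill j h = h) (hk : kill k h = h) (h0 : h != 0).
Local Notation rho := ('X_j * 'X_k - h).

(** Up to a power of ['X_j], the variable ['X_k] can be eliminated modulo the
    equation, as ['X_j * 'X_k] is congruent to [h]. *)
Lemma hypersurface_elim p :
  exists N q a, 'X_j ^+ N * p = q + a * rho /\ kill k q = q.
Proof.
have kXj : kill k 'X_j = 'X_j :> {mpoly K[n]} by rewrite killXU (negPf njk).
have kXjN N : kill k ('X_j ^+ N) = 'X_j ^+ N :> {mpoly K[n]}.
  by rewrite /kill rmorphXn /=; congr (_ ^+ _).
elim/mpoly_alg_ind: p => [c|i||].
- by exists 0, c%:MP, 0; rewrite expr0 mul1r mul0r addr0 /kill comp_mpolyC.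
- have [->|nik] := eqVneq i k.
    by exists 1, h, 1; split=> //; rewrite expr1; ring.
  by exists 0, 'X_i, 0; rewrite killXU (negPf nik); split=> //; ring.
- move=> p q [N [p' [a [ep kp]]]] [M [q' [b [eq kq]]]].
  exists (N + M)%N, ('X_j ^+ M * p' + 'X_j ^+ N * q'),
    ('X_j ^+ M * a + 'X_j ^+ N * b); split.
    transitivity ('X_j ^+ M * ('X_j ^+ N * p) + 'X_j ^+ N * ('X_j ^+ M * q)).
      by rewrite exprD; ring.
    by rewrite ep eq; ring.
  by rewrite killD !killM !kXjN kp kq.
- move=> p q [N [p' [a [ep kp]]]] [M [q' [b [eq kq]]]].
  exists (N + M)%N, (p' * q'), (p' * b + a * q' + a * b * rho); split.
    transitivity (('X_j ^+ N * p) * ('X_j ^+ M * q)).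
      by rewrite exprD; ring.
    by rewrite ep eq; ring.
  by rewrite killM kp kq.
Qed.

(** ['X_j] is not a zero divisor modulo the equation: at ['X_j = 0], [rho]
    becomes the nonzero polynomial [- h]. *)
Lemma hypersurface_cancel N p a :
  'X_j ^+ N * p = a * rho -> exists b, p = b * rho.
Proof.
elim: N a => [|N IH] a; first by rewrite expr0 mul1r; exists a.
rewrite exprS -mulrA => e.
have /kill_eq0[c ac] : kill j a = 0.
  apply/eqP; have := congr1 (kill j) e.
  rewrite !killM killD killN killM killXU eqxx hj !mul0r sub0r => /esym/eqP.
  by rewrite mulf_eq0 oppr_eq0 (negPf h0) orbF.
apply: (IH c); apply: (mulfI (mpolyXU_neq0 j)); rewrite e ac; ring.
Qed.

(** The coordinate of index [k] is left unconstrained because it is determined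
    by the equation, and may be 0. *)
Lemma hypersurface_nullstellensatz p :
  (forall w, w j * w k = h.@[w] -> (forall i, i != k -> w i != 0) ->
     p.@[w] = 0) ->
  exists a, p = a * rho.
Proof.
move=> p0; have [N [q [a [e kq]]]] := hypersurface_elim p.
suff q0 : q = 0 by move: e; rewrite q0 add0r => /hypersurface_cancel.
(* The product makes the vanishing of q trivial where hypothesis p0 does not
   apply. *)
have : q * \prod_(i | i != k) 'X_i = 0.
  apply: mpoly_fun_eq0 => v; rewrite mevalM rmorph_prod /=.
  case: (pickP (fun i => (i != k) && (v i == 0))) => [i /andP[ik /eqP vi]|vn0].
    by rewrite (bigD1 i) //= mevalXU vi mul0r mulr0.
  have nz i : i != k -> v i != 0.
    by move=> ik; have := vn0 i; rewrite ik => /negbT.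
  pose w i := if i == k then h.@[v] / v j else v i.
  have vw i : i != k -> v i = w i by rewrite /w => /negPf ->.
  have hw : h.@[w] = h.@[v] by apply/esym/(kill_indep hk).
  have rw : w j * w k = h.@[w].
    by rewrite hw /w eqxx (negPf njk) mulrC divfK // nz.
  have -> : q.@[v] = q.@[w] by apply: kill_indep kq vw.
  have := congr1 (meval w) e.
  rewrite mevalM mevalD mevalM mevalB mevalM !mevalXU.
  rewrite rw subrr mulr0 addr0 p0 ?mulr0 => [<-||i ik]; rewrite ?mul0r //.
  by rewrite -vw ?nz.
move/eqP; rewrite mulf_eq0 => /orP[/eqP //|].
by rewrite prodf_seq_eq0 => /hasP[i _]; rewrite (negPf (mpolyXU_neq0 i)) andbF.
Qed.

End Hypersurface.
End Kill.

(** * 3 x 3 matrices and the generators *)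

Local Notation o0 := (@Ordinal 3 0 isT).
Local Notation o1 := (@Ordinal 3 1 isT).
Local Notation o2 := (@Ordinal 3 2 isT).

Lemma ord3P (P : 'I_3 -> Prop) : P o0 -> P o1 -> P o2 -> forall i, P i.
Proof.
move=> P0 P1 P2 [[|[|[|//]]] lti].
- by rewrite (_ : Ordinal lti = o0) //; apply: val_inj.
- by rewrite (_ : Ordinal lti = o1) //; apply: val_inj.
- by rewrite (_ : Ordinal lti = o2) //; apply: val_inj.
Qed.

Lemma sum3E (V : nmodType) (F : 'I_3 -> V) : \sum_i F i = F o0 + F o1 + F o2.
Proof.
by rewrite !big_ord_recr big_ord0 /= add0r; congr (F _ + F _ + F _);
  apply: val_inj.
Qed.

Lemma det2E (R : comNzRingType) (A : 'M[R]_2) :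
  let a0 := @Ordinal 2 0 isT in let a1 := @Ordinal 2 1 isT in
  \det A = A a0 a0 * A a1 a1 - A a0 a1 * A a1 a0.
Proof.
rewrite /= (expand_det_row _ ord0) !big_ord_recl big_ord0 /cofactor !det_mx11.
rewrite !mxE /= expr0 expr1 mul1r addr0 mulN1r mulrN.
by congr (A _ _ * A _ _ - A _ _ * A _ _); apply: val_inj.
Qed.

Lemma det3E (R : comNzRingType) (A : 'M[R]_3) :
  \det A = A o0 o0 * (A o1 o1 * A o2 o2 - A o1 o2 * A o2 o1)
         - A o0 o1 * (A o1 o0 * A o2 o2 - A o1 o2 * A o2 o0)
         + A o0 o2 * (A o1 o0 * A o2 o1 - A o1 o1 * A o2 o0).
Proof.
rewrite (expand_det_row _ ord0) sum3E /cofactor !det2E !mxE /=.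
rewrite (_ : ord0 = o0); last exact: val_inj.
rewrite (_ : lift o0 (Ordinal _) = o1); last exact: val_inj.
rewrite (_ : lift o0 (Ordinal _) = o2); last exact: val_inj.
rewrite (_ : lift o1 (Ordinal _) = o0); last exact: val_inj.
rewrite (_ : lift o1 (Ordinal _) = o2); last exact: val_inj.
rewrite (_ : lift o2 (Ordinal _) = o0); last exact: val_inj.
rewrite (_ : lift o2 (Ordinal _) = o1); last exact: val_inj.
by rewrite expr0 expr1 expr2; ring.
Qed.

Lemma mulmx3E (R : comNzRingType) (A B : 'M[R]_3) i j :
  (A *m B) i j = A i o0 * B o0 j + A i o1 * B o1 j + A i o2 * B o2 j.
Proof. by rewrite mxE sum3E. Qed.

(** The matrix with rows [a b c], [d e f] and [g h k]. *)
Definition mx3 (R : nzRingType) (a b c d e f g h k : R) : 'M[R]_3 :=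
  \matrix_(i, j)
    nth 0 (nth [::] [:: [:: a; b; c]; [:: d; e; f]; [:: g; h; k]] i) j.

Section Generators.
Variable K : numFieldType.
Implicit Types (x y m u : 'M[K]_3).
Local Notation ev x y := (meval (tnth (pair_coords x y))).

(** Every point of affine 18-space is given by a pair of matrices. *)
Lemma pair_coords_surj (v : 'I_(3 * 3 + 3 * 3) -> K) :
  exists x y, v =1 tnth (pair_coords x y).
Proof.
pose r : 'rV_(3 * 3 + 3 * 3) := \row_i v i.
exists (vec_mx (lsubmx r)), (vec_mx (rsubmx r)) => i.
by rewrite tnth_mktuple !vec_mxK hsubmxK mxE.
Qed.

Lemma ev_coords x y :
  map_mx (ev x y) (row_mx (xmx K 3) (ymx K 3)) = row_mx x y.
Proof.
rewrite map_row_mx; congr (row_mx _ _); apply/matrixP => i j.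
  by rewrite !mxE mevalXU tnth_mktuple row_mxEl mxvecE.
by rewrite !mxE mevalXU tnth_mktuple row_mxEr mxvecE.
Qed.

(** The entry in row [a] and column [b], counted from 0, of the matrix made of
    the first [i] columns of [x] followed by the columns [js] of [y]. *)
Definition minor_entry x y (i : nat) (js : seq 'I_3) (a b : nat) : K :=
  if (b < i)%N then x (inord a) (inord b)
  else y (inord a) (nth ord0 js (b - i)).

Lemma minor_eval (i k : nat) (js : k.-tuple 'I_3) (ik : (i + k <= 3)%N) x y :
  ev x y (minor K js ik) =
  \det (\matrix_(a < i + k, b < i + k) minor_entry x y i js a b).
Proof.
rewrite /minor -det_map_mx map_mxsub ev_coords; congr (\det _).
apply/matrixP => a b; rewrite [LHS]mxE [RHS]mxE /minor_entry.
have -> : widen_ord ik a = inord a.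
  by apply: val_inj; rewrite /= inordK // (leq_trans (ltn_ord a)).
rewrite /minor_col; case: splitP => l bl.
  rewrite row_mxEl bl; congr (x _ _).
  apply: val_inj; rewrite /= inordK // (leq_trans (ltn_ord l)) //.
  by rewrite (leq_trans _ ik) // leq_addr.
by rewrite row_mxEr bl addKn (tnth_nth ord0).
Qed.

(** The values of g1, ..., g10, in this order, at a pair of matrices. *)
Definition gval x y (i : 'I_10) : K :=
  nth 0 [::
    y o0 o0;
    \det y;
    y o0 o0 * y o1 o1 - y o0 o1 * y o1 o0;
    x o0 o0;
    x o0 o0 * y o1 o0 - y o0 o0 * x o1 o0;
    x o0 o0 * (y o1 o0 * y o2 o1 - y o1 o1 * y o2 o0)
      - y o0 o0 * (x o1 o0 * y o2 o1 - y o1 o1 * x o2 o0)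
      + y o0 o1 * (x o1 o0 * y o2 o0 - y o1 o0 * x o2 o0);
    x o0 o0 * x o1 o1 - x o0 o1 * x o1 o0;
    x o0 o0 * (x o1 o1 * y o2 o0 - y o1 o0 * x o2 o1)
      - x o0 o1 * (x o1 o0 * y o2 o0 - y o1 o0 * x o2 o0)
      + y o0 o0 * (x o1 o0 * x o2 o1 - x o1 o1 * x o2 o0);
    \det x;
    (x o0 o0 * (x o1 o1 * y o2 o1 - y o1 o1 * x o2 o1)
      - x o0 o1 * (x o1 o0 * y o2 o1 - y o1 o1 * x o2 o0)
      + y o0 o1 * (x o1 o0 * x o2 o1 - x o1 o1 * x o2 o0)) * y o0 o0
    - (x o0 o0 * (x o1 o1 * y o2 o0 - y o1 o0 * x o2 o1)
      - x o0 o1 * (x o1 o0 * y o2 o0 - y o1 o0 * x o2 o0)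
      + y o0 o0 * (x o1 o0 * x o2 o1 - x o1 o1 * x o2 o0)) * y o0 o1] i.

Lemma inord3E :
  (inord 0 = o0 :> 'I_3) * (inord 1 = o1 :> 'I_3) * (inord 2 = o2 :> 'I_3).
Proof. by split; [split|]; apply: val_inj; rewrite /= inordK. Qed.

Lemma gens_eval x y i : ev x y (tnth (TA3_gens K) i) = gval x y i.
Proof.
rewrite (tnth_nth 0) /gval.
case: i => [[|[|[|[|[|[|[|[|[|[|//]]]]]]]]]] lti] /=;
  rewrite ?mevalB ?mevalM !minor_eval ?det3E ?(det_mx11, det2E) !mxE
    /minor_entry /= ?inord3E //.
Qed.

Lemma gens_comp_eval (p : {mpoly K[10]}) x y :
  ev x y (p \mPo TA3_gens K) = p.@[gval x y].
Proof.
by rewrite comp_mpoly_meval; apply: meval_eq => i; rewrite gens_eval.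
Qed.

Lemma gval_lmul u x y : unitriangular u ->
  gval (u^T *m x) (u^T *m y) =1 gval x y.
Proof.
move=> [u1 u0] i; have := (u0 o1 o0 isT, u0 o2 o0 isT, u0 o2 o1 isT).
move: (u1 o0) (u1 o1) (u1 o2) => e0 e1 e2 [[e3 e4] e5].
rewrite /gval; case: i => [[|[|[|[|[|[|[|[|[|[|//]]]]]]]]]] lti] /=;
  rewrite ?det3E !mulmx3E !mxE e0 ?e1 ?e2 ?e3 ?e4 ?e5; ring.
Qed.

Lemma gval_rmul u w x y : unitriangular u -> unitriangular w ->
  gval (x *m u) (y *m w) =1 gval x y.
Proof.
move=> [u1 u0] [w1 w0] i; have := (u0 o1 o0 isT, u0 o2 o0 isT, u0 o2 o1 isT).
have := (w0 o1 o0 isT, w0 o2 o0 isT, w0 o2 o1 isT).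
move: (u1 o0) (u1 o1) (u1 o2) (w1 o0) (w1 o1) (w1 o2) => e0 e1 e2 f0 f1 f2.
move=> [[f3 f4] f5] [[e3 e4] e5].
rewrite /gval; case: i => [[|[|[|[|[|[|[|[|[|[|//]]]]]]]]]] lti] /=;
  rewrite ?det3E !mulmx3E ?(e0,e1,e2,e3,e4,e5,f0,f1,f2,f3,f4,f5); ring.
Qed.

Lemma gens_comp_in_TA (p : {mpoly K[10]}) : p \mPo TA3_gens K \in TA K 3.
Proof.
apply/asboolP => u1 u2 u3 U1 U2 U3; apply: mpoly_fun_inj => v.
have [x [y vE]] := pair_coords_surj v; rewrite !(meval_eq _ vE) act_eval.
rewrite !gens_comp_eval; apply: meval_eq => i.
by rewrite gval_rmul // gval_lmul.
Qed.

End Generators.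

(** * Normal forms *)

Section NormalForm.
Variable K : numFieldType.
Implicit Types (x y m u : 'M[K]_3).

Lemma unitriangular_mx3 (a b c : K) : unitriangular (mx3 1 a b 0 1 c 0 0 1).
Proof.
by split; [elim/ord3P | elim/ord3P; elim/ord3P => //]; rewrite ?mxE.
Qed.

Lemma unitriangular1 : unitriangular (1%:M : 'M[K]_3).
Proof.
by split=> [i|i j ji]; rewrite mxE ?eqxx // -val_eqE /= gtn_eqF.
Qed.

(** Column elimination; the coefficients come from Cramer's rule. *)
Lemma lower_triangular_form m :
  m o0 o0 != 0 -> m o0 o0 * m o1 o1 - m o0 o1 * m o1 o0 != 0 ->
  exists2 u, unitriangular u &
    [/\ (m *m u) o0 o1 = 0, (m *m u) o0 o2 = 0 & (m *m u) o1 o2 = 0].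
Proof.
set d := _ - _ => m0 d0.
exists (mx3 1 (- m o0 o1 / m o0 o0)
                ((m o0 o1 * m o1 o2 - m o0 o2 * m o1 o1) / d)
            0 1 (- (m o0 o0 * m o1 o2 - m o0 o2 * m o1 o0) / d)
            0 0 1); first exact: unitriangular_mx3.
split; rewrite mulmx3E !mxE /=.
- by field.
- by rewrite /d in d0 *; field; rewrite ?d0.
- by rewrite /d in d0 *; field; rewrite ?d0.
Qed.

Lemma diagonal_form m :
  m o0 o0 != 0 -> m o0 o0 * m o1 o1 - m o0 o1 * m o1 o0 != 0 ->
  exists u1 u2, [/\ unitriangular u1, unitriangular u2 &
    forall i j, i != j -> (u1^T *m m *m u2) i j = 0].
Proof.
move=> m0 d0; have [u2 U2 [t01 t02 t12]] := lower_triangular_form m0 d0.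
set t := m *m u2 in t01 t02 t12.
have [u2_1 u2_0] := U2.
have t00 : t o0 o0 = m o0 o0 by rewrite mulmx3E u2_1 !u2_0 //; ring.
have t11 : t o0 o0 * t o1 o1 = m o0 o0 * m o1 o1 - m o0 o1 * m o1 o0.
  transitivity (t o0 o0 * t o1 o1 - t o0 o1 * t o1 o0).
    by rewrite t01 mul0r subr0.
  rewrite /t !mulmx3E !u2_1.
  by rewrite (u2_0 o1 o0) // (u2_0 o2 o0) // (u2_0 o2 o1) //; ring.
have tT i j : t^T i j = t j i by rewrite mxE.
(* Column elimination on the transpose of t is row elimination on t, and it
   keeps the transpose of t upper triangular. *)
have [||u1 U1] := @lower_triangular_form t^T; rewrite ?tT.
- by rewrite t00.
- by rewrite t01 mulr0 subr0 t11.
move=> [s01 s02 s12]; exists u1, u2; split=> //.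
have [u1_1 u1_0] := U1.
have -> : u1^T *m m *m u2 = (t^T *m u1)^T by rewrite trmx_mul trmxK mulmxA.
elim/ord3P; elim/ord3P => // _; rewrite mxE //;
  rewrite mulmx3E !tT !u1_1 ?(u1_0 o1 o0) ?(u1_0 o2 o0) ?(u1_0 o2 o1) //;
  rewrite ?(t01,t02,t12); ring.
Qed.


End NormalForm.

(** * Points over the hypersurface *)

(** [ik] is the index of the variable z_k, counted from 1 as in g_k. *)
Local Notation i1 := (@inord 9 0).
Local Notation i2 := (@inord 9 1).
Local Notation i3 := (@inord 9 2).
Local Notation i4 := (@inord 9 3).
Local Notation i5 := (@inord 9 4).
Local Notation i6 := (@inord 9 5).
Local Notation i7 := (@inord 9 6).
Local Notation i8 := (@inord 9 7).
Local Notation i9 := (@inord 9 8).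
Local Notation i10 := (@inord 9 9).

Lemma ord10P (P : 'I_10 -> Prop) :
  P i1 -> P i2 -> P i3 -> P i4 -> P i5 -> P i6 -> P i7 -> P i8 -> P i9 ->
  P i10 -> forall i, P i.
Proof.
move=> ? ? ? ? ? ? ? ? ? ? i; rewrite -(inord_val i).
by case: i => [[|[|[|[|[|[|[|[|[|[|//]]]]]]]]]] lti].
Qed.

Section Sections.
Variable K : numFieldType.
Implicit Types (x y : 'M[K]_3) (w : 'I_10 -> K).

(** The zero set of the relation, with z5 z10 isolated. *)
Definition on_hypersurface w :=
  w i5 * w i10 = w i1 * w i6 * w i7 + w i3 * w i4 * w i8.

Lemma gval_on_hypersurface x y : on_hypersurface (gval x y).
Proof. by rewrite /on_hypersurface /gval !inordK //=; ring. Qed.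

(** The normal form of the pairs of matrices at which the generators take the
    values [w]: the diagonal matrix [normal_x w] and the lower triangular matrix
    [normal_y w].  The value of g6 is not needed, as the relation
    determines it. *)
Definition normal_x w : 'M[K]_3 :=
  mx3 (w i4) 0 0  0 (w i7 / w i4) 0  0 0 (w i9 / w i7).

Definition normal_y w : 'M[K]_3 :=
  mx3 (w i1) 0 0  (w i5 / w i4) (w i3 / w i1) 0
      (w i8 / w i7) (w i10 / (w i7 * w i1)) (w i2 / w i3).

Lemma gval_normal w : on_hypersurface w ->
  w i1 != 0 -> w i3 != 0 -> w i4 != 0 -> w i7 != 0 ->
  gval (normal_x w) (normal_y w) =1 w.
Proof.
rewrite /on_hypersurface => hw n1 n3 n4 n7.
have w6 : w i6 = (w i5 * w i10 - w i3 * w i4 * w i8) / (w i1 * w i7).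
  by rewrite hw; field; rewrite ?n1 ?n7.
by elim/ord10P; rewrite /gval inordK //= ?det3E !mxE /= ?w6; field;
  rewrite ?n1 ?n3 ?n4 ?n7.
Qed.

(** A diagonal matrix and a lower triangular one are determined by the values of
    the generators at them, where the denominators do not vanish. *)
Lemma normal_gval x y :
  (forall i j, i != j -> x i j = 0) ->
  y o0 o1 = 0 -> y o0 o2 = 0 -> y o1 o2 = 0 ->
  let w := gval x y in
  w i1 != 0 -> w i3 != 0 -> w i4 != 0 -> w i7 != 0 ->
  normal_x w = x /\ normal_y w = y.
Proof.
move=> x0 y01 y02 y12 w.
rewrite /normal_x /normal_y /w /gval !inordK //= !det3E.
have xE := (x0 o0 o1 isT, x0 o0 o2 isT, x0 o1 o0 isT, x0 o1 o2 isT,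
            x0 o2 o0 isT, x0 o2 o1 isT).
rewrite y01 y02 y12 !xE.
rewrite !(mul0r, mulr0, subr0, sub0r, addr0, add0r, oppr0).
move=> n1 n3 n4 n7.
have n3' : y o1 o1 != 0 by apply: contraNneq n3 => ->; rewrite mulr0.
have n7' : x o1 o1 != 0 by apply: contraNneq n7 => ->; rewrite mulr0.
split; apply/matrixP; elim/ord3P; elim/ord3P;
  rewrite mxE /= ?xE ?y01 ?y02 ?y12 //;
  by field; rewrite ?n1 ?n3' ?n4 ?n7'.
Qed.

(** The points of the hypersurface having exactly one zero coordinate, of index
    1, 3, 4 or 7, are values of the generators.  In each case the equation
    determines [w i10], and the matrices below are found by taking zeros
    wherever the ten equations [gval x y i = w i] leave a choice. *)
Lemma section_z1 w : on_hypersurface w -> w i1 = 0 ->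
  (forall i, i != i1 -> w i != 0) -> exists x y, gval x y =1 w.
Proof.
rewrite /on_hypersurface => hw w0 nz.
have nz' k : (k != 0) && (k < 10)%N -> w (inord k) != 0.
  by case/andP=> k0 k10; apply: nz; rewrite -val_eqE /= !inordK.
have [n3 n4 n5 n7] := And4 (nz' 2 isT) (nz' 3 isT) (nz' 4 isT) (nz' 6 isT).
have w10 : w i10 = w i3 * w i4 * w i8 / w i5.
  by apply: (mulfI n5); rewrite hw w0; field.
exists (normal_x w),
  (mx3 0 (- w i3 * w i4 / w i5) 0  (w i5 / w i4) 0 0
       (w i8 / w i7) (w i6 / w i5) (w i2 / w i3)).
by elim/ord10P; rewrite /gval inordK //= ?det3E !mxE /= ?w10 ?w0; field;
  rewrite ?n3 ?n4 ?n5 ?n7.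
Qed.

Lemma section_z3 w : on_hypersurface w -> w i3 = 0 ->
  (forall i, i != i3 -> w i != 0) -> exists x y, gval x y =1 w.
Proof.
rewrite /on_hypersurface => hw w0 nz.
have nz' k : (k != 2) && (k < 10)%N -> w (inord k) != 0.
  by case/andP=> k0 k10; apply: nz; rewrite -val_eqE /= !inordK.
have [n1 n4 n5 n7] := And4 (nz' 0 isT) (nz' 3 isT) (nz' 4 isT) (nz' 6 isT).
have n6 := nz' 5 isT.
have w10 : w i10 = w i1 * w i6 * w i7 / w i5.
  by apply: (mulfI n5); rewrite hw w0; field.
exists (normal_x w),
  (mx3 (w i1) 0 0  (w i5 / w i4) 0 (- w i2 * w i5 / (w i6 * w i1))
       (w i8 / w i7) (w i6 / w i5) 0).
by elim/ord10P; rewrite /gval inordK //= ?det3E !mxE /= ?w10 ?w0; field;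
  rewrite ?n1 ?n4 ?n5 ?n7 ?n6.
Qed.

Lemma section_z4 w : on_hypersurface w -> w i4 = 0 ->
  (forall i, i != i4 -> w i != 0) -> exists x y, gval x y =1 w.
Proof.
rewrite /on_hypersurface => hw w0 nz.
have nz' k : (k != 3) && (k < 10)%N -> w (inord k) != 0.
  by case/andP=> k0 k10; apply: nz; rewrite -val_eqE /= !inordK.
have [n1 n3 n5 n7] := And4 (nz' 0 isT) (nz' 2 isT) (nz' 4 isT) (nz' 6 isT).
have w10 : w i10 = w i1 * w i6 * w i7 / w i5.
  by apply: (mulfI n5); rewrite hw w0; field.
exists (mx3 0 (w i7 * w i1 / w i5) 0  (- w i5 / w i1) 0 0  0 0 (w i9 / w i7)),
  (mx3 (w i1) 0 0  0 (w i3 / w i1) 0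
       (w i8 / w i7) (w i6 / w i5) (w i2 / w i3)).
by elim/ord10P; rewrite /gval inordK //= ?det3E !mxE /= ?w10 ?w0; field;
  rewrite ?n1 ?n3 ?n5 ?n7.
Qed.

Lemma section_z7 w : on_hypersurface w -> w i7 = 0 ->
  (forall i, i != i7 -> w i != 0) -> exists x y, gval x y =1 w.
Proof.
rewrite /on_hypersurface => hw w0 nz.
have nz' k : (k != 6) && (k < 10)%N -> w (inord k) != 0.
  by case/andP=> k0 k10; apply: nz; rewrite -val_eqE /= !inordK.
have [n1 n3 n4 n5] := And4 (nz' 0 isT) (nz' 2 isT) (nz' 3 isT) (nz' 4 isT).
have n8 := nz' 7 isT.
have w10 : w i10 = w i3 * w i4 * w i8 / w i5.
  by apply: (mulfI n5); rewrite hw w0; field.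
exists (mx3 (w i4) 0 0  0 0 (w i9 * w i5 / (w i4 * w i8))  0 (- w i8 / w i5) 0),
  (mx3 (w i1) 0 0  (w i5 / w i4) (w i3 / w i1) 0
       0 (w i6 / w i5) (w i2 / w i3)).
by elim/ord10P; rewrite /gval inordK //= ?det3E !mxE /= ?w10 ?w0; field;
  rewrite ?n1 ?n3 ?n4 ?n5 ?n8.
Qed.

Lemma section_at i w : i \in [:: i1; i3; i4; i7] -> on_hypersurface w ->
  w i = 0 -> (forall j, j != i -> w j != 0) -> exists x y, gval x y =1 w.
Proof.
rewrite !inE => /or4P[] /eqP ->;
  [exact: section_z1|exact: section_z3|exact: section_z4|exact: section_z7].
Qed.

End Sections.

(** * Relations and generation *)

Section Generation.
Variable K : numFieldType.
Implicit Types (x y : 'M[K]_3) (w : 'I_10 -> K) (p q : {mpoly K[10]}).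
Implicit Types f : {mpoly K[3 * 3 + 3 * 3]}.
Local Notation gens := (TA3_gens K).
Local Notation r := (TA3_relation K).
Local Notation ev x y := (meval (tnth (pair_coords x y))).

Lemma relation_eval w :
  r.@[w] = w i1 * w i6 * w i7 - w i5 * w i10 + w i3 * w i4 * w i8.
Proof. by rewrite /TA3_relation mevalD mevalB !mevalM !mevalXU. Qed.

Lemma relation_comp0 : r \mPo gens = 0.
Proof.
apply: mpoly_fun_eq0 => v; have [x [y vE]] := pair_coords_surj v.
rewrite (meval_eq _ vE) gens_comp_eval relation_eval.
by rewrite [X in _ - X]gval_on_hypersurface; ring.
Qed.

Lemma gens_comp_funP f p :
  (forall x y, ev x y f = p.@[gval x y]) -> f = p \mPo gens.
Proof.
move=> fE; apply: mpoly_fun_inj => v; have [x [y vE]] := pair_coords_surj v.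
by rewrite !(meval_eq _ vE) fE gens_comp_eval.
Qed.

(** The part of the relation that is free of z5 and z10. *)
Definition rel_head : {mpoly K[10]} :=
  'X_i1 * 'X_i6 * 'X_i7 + 'X_i3 * 'X_i4 * 'X_i8.

Lemma relationE : r = rel_head - 'X_i5 * 'X_i10.
Proof. by rewrite /TA3_relation /rel_head /=; ring. Qed.

Lemma rel_head_eval w :
  rel_head.@[w] = w i1 * w i6 * w i7 + w i3 * w i4 * w i8.
Proof. by rewrite /rel_head mevalD !mevalM !mevalXU. Qed.

Lemma idx_neq (a b : nat) : (a < 10)%N -> (b < 10)%N -> a != b ->
  (@inord 9 a == @inord 9 b) = false.
Proof. by move=> a9 b9 ab; rewrite -val_eqE /= !inordK // (negPf ab). Qed.

Lemma kill_rel_head (j : 'I_10) :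
  j \in [:: i5; i10] -> kill j rel_head = rel_head.
Proof.
rewrite !inE => /orP[] /eqP ->;
  by rewrite /rel_head killD !killM !killXU !idx_neq.
Qed.

Lemma killC (n : nat) (j k : 'I_n) (p : {mpoly K[n]}) :
  kill j (kill k p) = kill k (kill j p).
Proof.
apply: mpoly_fun_inj => v; rewrite !kill_meval; apply: meval_eq => i.
by case: eqP; case: eqP.
Qed.

(** The basic relation generates the ideal of relations. *)
Lemma relation_ideal_generated p : p \mPo gens = 0 -> exists q, p = q * r.
Proof.
move=> p0.
have [|||||a ->] := @hypersurface_nullstellensatz _ K i5 i10 rel_head _ _ _ _ p.
- by rewrite idx_neq.
- by rewrite kill_rel_head // !inE eqxx.
- by rewrite kill_rel_head // !inE eqxx orbT.
- apply/eqP => /(congr1 (meval (fun=> 1))); rewrite rel_head_eval meval0 !mulr1.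
  by move/eqP; rewrite -(natrD _ 1 1) pnatr_eq0.
- move=> w; rewrite rel_head_eval => hw nz.
  have gw := gval_normal hw; rewrite -(meval_eq _ (gw _ _ _ _)) ?nz ?idx_neq //.
  by rewrite -gens_comp_eval p0 meval0.
by exists (- a); rewrite relationE; ring.
Qed.

Lemma gens_neq0 i : i \in [:: i1; i3; i4; i7] -> tnth gens i != 0.
Proof.
move=> hi; apply/eqP => /(congr1 (ev 1%:M 1%:M)); rewrite gens_eval meval0.
move: hi; rewrite !inE => /or4P[] /eqP -> /eqP;
  by rewrite /gval inordK //= !mxE /= ?mulr1 ?mulr0 ?subr0 oner_eq0.
Qed.

(** An element of the algebra of the generators that is divisible by g1, g3, g4
    or g7 as a polynomial is divisible by it in that algebra. *)
Lemma gens_comp_divides i f p : i \in [:: i1; i3; i4; i7] ->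
  tnth gens i * f = p \mPo gens -> exists q, f = q \mPo gens.
Proof.
move=> hi e.
have [ni5 ni10] : i5 != i /\ i10 != i.
  by split; apply: contraTneq hi => <-; rewrite !inE !idx_neq.
(* Setting z_i to 0 kills one of the two monomials and keeps the other. *)
have kn : kill i rel_head != 0.
  apply/eqP => /(congr1 (meval (fun=> 1))); rewrite kill_meval rel_head_eval.
  rewrite meval0; move: hi; rewrite !inE => /or4P[] /eqP ->;
    rewrite !eqxx !idx_neq //= => /eqP;
    by rewrite !(mulr1, mul0r, mulr0, addr0, add0r) oner_eq0.
have [|||||a ea] :=
  @hypersurface_nullstellensatz _ K i5 i10 (kill i rel_head) _ _ _ _ (kill i p).
- by rewrite idx_neq.
- by rewrite killC kill_rel_head // !inE eqxx.
- by rewrite killC kill_rel_head // !inE eqxx orbT.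
- exact: kn.
- move=> w; rewrite !kill_meval rel_head_eval => hw nz.
  (* w' is w with its coordinate of index i replaced by 0. *)
  set w' := fun j => _ in hw *.
  have hw' : on_hypersurface w' by rewrite /on_hypersurface -hw /w' !ifN.
  have w'i : w' i = 0 by rewrite /w' eqxx.
  have nz' j : j != i -> w' j != 0.
    move=> ji; rewrite /w' ifN //; have [->|/nz//] := eqVneq j i10.
    apply/eqP => w10; move: hw; rewrite w10 mulr0 /w'.
    move: hi; rewrite !inE => /or4P[] /eqP ->;
      rewrite !eqxx !idx_neq // !(mul0r, mulr0, addr0, add0r) => /esym/eqP;
      by rewrite !mulf_eq0 !(negPf (nz _ _)) ?idx_neq.
  have [x [y gE]] := section_at hi hw' w'i nz'.
  by rewrite -(meval_eq _ gE) -gens_comp_eval -e mevalM gens_eval gE w'i mul0r.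
have [b eb] := kill_subP i p; have [c ec] := kill_subP i rel_head.
have {}ec : kill i rel_head = rel_head - c * 'X_i by rewrite {2}ec addrK.
have {ea}ep : p = - a * r + (a * c + b) * 'X_i.
  by rewrite eb ea ec relationE; ring.
exists (a * c + b).
have gn := gens_neq0 hi.
apply: (mulfI gn); rewrite e ep rmorphD !rmorphM /= relation_comp0 mulr0 add0r.
by rewrite comp_mpolyXU (tnth_nth 0) mulrC.
Qed.

(** The product of the values of the generators that occur in the denominators
    of the normal form. *)
Definition denom w : K := w i1 * w i3 * w i4 * w i7.

(** Functions of the form q / denom^N, [q] being a polynomial. *)
Definition regular_denom (phi : ('I_10 -> K) -> K) : Prop :=
  exists N q, forall w, denom w != 0 -> denom w ^+ N * phi w = q.@[w].

Lemma regular_denom_ext phi psi :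
  phi =1 psi -> regular_denom phi -> regular_denom psi.
Proof. by move=> e [N [q h]]; exists N, q => w; rewrite -e; apply: h. Qed.

Lemma regular_denom_eval q : regular_denom (fun w => q.@[w]).
Proof. by exists 0, q => w _; rewrite expr0 mul1r. Qed.

Lemma regular_denom_var i : regular_denom (fun w => w i).
Proof.
by apply: regular_denom_ext (regular_denom_eval 'X_i) => w; rewrite mevalXU.
Qed.

Lemma regular_denom_cst (c : K) : regular_denom (fun=> c).
Proof.
by apply: regular_denom_ext (regular_denom_eval c%:MP) => w; rewrite mevalC.
Qed.

Lemma regular_denomD phi psi : regular_denom phi -> regular_denom psi ->
  regular_denom (fun w => phi w + psi w).
Proof.
pose d : {mpoly K[10]} := 'X_i1 * 'X_i3 * 'X_i4 * 'X_i7.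
have dE w : d.@[w] = denom w by rewrite !mevalM !mevalXU.
move=> [N [p hp]] [M [q hq]]; exists (N + M)%N, (d ^+ M * p + d ^+ N * q).
move=> w dn.
by rewrite mevalD !mevalM !rmorphXn /= dE -hp // -hq // exprD; ring.
Qed.

Lemma regular_denomM phi psi : regular_denom phi -> regular_denom psi ->
  regular_denom (fun w => phi w * psi w).
Proof.
move=> [N [p hp]] [M [q hq]]; exists (N + M)%N, (p * q) => w dn.
by rewrite mevalM -hp // -hq // exprD; ring.
Qed.

Lemma denom_neq0P w :
  reflect [/\ w i1 != 0, w i3 != 0, w i4 != 0 & w i7 != 0] (denom w != 0).
Proof. by rewrite /denom !mulf_eq0 !negb_or -!andbA; exact: and4P. Qed.

Lemma regular_denomV i : i \in [:: i1; i3; i4; i7] ->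
  regular_denom (fun w => (w i)^-1).
Proof.
have V q : (forall w, denom w = w i * q.@[w]) ->
    regular_denom (fun w => (w i)^-1).
  move=> dE; exists 1, q => w dn; rewrite expr1 dE mulrC mulKf //.
  by move: dn; rewrite dE mulf_eq0 negb_or => /andP[].
rewrite !inE /denom in V * => /or4P[] /eqP ei; rewrite ei in V *.
- by apply: (V ('X_i3 * 'X_i4 * 'X_i7)) => w; rewrite !mevalM !mevalXU; ring.
- by apply: (V ('X_i1 * 'X_i4 * 'X_i7)) => w; rewrite !mevalM !mevalXU; ring.
- by apply: (V ('X_i1 * 'X_i3 * 'X_i7)) => w; rewrite !mevalM !mevalXU; ring.
- by apply: (V ('X_i1 * 'X_i3 * 'X_i4)) => w; rewrite !mevalM !mevalXU; ring.
Qed.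

Lemma regular_denom_normal_x i j : regular_denom (fun w => normal_x w i j).
Proof.
have ext phi : regular_denom phi -> (fun w => normal_x w i j) =1 phi ->
    regular_denom (fun w => normal_x w i j).
  by move=> h e; apply: regular_denom_ext h => w; rewrite e.
have V := regular_denomV; have X := regular_denom_var; have M := regular_denomM.
move: i j ext; elim/ord3P; elim/ord3P => ext;
  (apply: ext; last by (move=> w; rewrite mxE /=; reflexivity));
  do ?apply: M; do ?[exact: regular_denom_cst|exact: X];
  by apply: V; rewrite !inE eqxx ?orbT.
Qed.

Lemma regular_denom_normal_y i j : regular_denom (fun w => normal_y w i j).
Proof.
have ext phi : regular_denom phi -> (fun w => normal_y w i j) =1 phi ->
    regular_denom (fun w => normal_y w i j).
  by move=> h e; apply: regular_denom_ext h => w; rewrite e.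
have V := regular_denomV; have X := regular_denom_var; have M := regular_denomM.
have W : regular_denom (fun w => w i10 / (w i7 * w i1)).
  apply: regular_denom_ext (M _ _ (X i10) (M _ _ (V i7 _) (V i1 _))) => [w||].
  - by rewrite invfM.
  - by rewrite !inE eqxx ?orbT.
  - by rewrite !inE eqxx ?orbT.
move: i j ext; elim/ord3P; elim/ord3P => ext;
  (apply: ext; last by (move=> w; rewrite mxE /=; reflexivity));
  do ?[exact: W|exact: regular_denom_cst|exact: X];
  by apply: M; [exact: X | apply: V; rewrite !inE eqxx ?orbT].
Qed.

Lemma regular_denom_normal_form f :
  regular_denom (fun w => ev (normal_x w) (normal_y w) f).
Proof.
elim/mpoly_alg_ind: f => [c|k|f g hf hg|f g hf hg].
- by apply: regular_denom_ext (regular_denom_cst c) => w; rewrite mevalC.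
- suff :
    regular_denom (fun w => tnth (pair_coords (normal_x w) (normal_y w)) k).
    by apply: regular_denom_ext => w; rewrite mevalXU.
  case: (split_ordP k) => l -> {k}; case/mxvec_indexP: l => i j.
    apply: regular_denom_ext (regular_denom_normal_x i j) => w.
    by rewrite tnth_mktuple row_mxEl mxvecE.
  apply: regular_denom_ext (regular_denom_normal_y i j) => w.
  by rewrite tnth_mktuple row_mxEr mxvecE.
- by apply: regular_denom_ext (regular_denomD hf hg) => w; rewrite mevalD.
- by apply: regular_denom_ext (regular_denomM hf hg) => w; rewrite mevalM.
Qed.

(** An invariant takes the same value at a pair of matrices and at its normal
    form. *)
Lemma TA_eval f x y : f \in TA K 3 -> denom (gval x y) != 0 ->
  ev x y f = ev (normal_x (gval x y)) (normal_y (gval x y)) f.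
Proof.
move=> /asboolP fI dn; have [n1 n3 n4 n7] := denom_neq0P _ dn.
have [x0 xd] : x o0 o0 != 0 /\ x o0 o0 * x o1 o1 - x o0 o1 * x o1 o0 != 0.
  by move: n4 n7; rewrite /gval !inordK.
have [u1 [u2 [U1 U2 xD]]] := diagonal_form x0 xd.
set y1 := u1^T *m y.
have g1 : gval (u1^T *m x *m u2) y1 =1 gval x y.
  move=> i; rewrite -(gval_lmul x y U1 i) -[y1]mulmx1 gval_rmul //.
  exact: unitriangular1.
have [y0 yd] : y1 o0 o0 != 0 /\ y1 o0 o0 * y1 o1 o1 - y1 o0 o1 * y1 o1 o0 != 0.
  by move: n1 n3; rewrite -!g1 /gval !inordK.
have [u3 U3 [z01 z02 z12]] := lower_triangular_form y0 yd.
rewrite -{1}(fI _ _ _ U1 U2 U3) act_eval -/y1.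
set x' := u1^T *m x *m u2 in xD g1 *; set y' := y1 *m u3 in z01 z02 z12 *.
have gE : gval x y =1 gval x' y'.
  by move=> i; rewrite gval_rmul // gval_lmul.
have gM : gval x y = gval x' y' by apply: funext.
have /= := normal_gval xD z01 z02 z12.
by rewrite -gM => /(_ n1 n3 n4 n7)[-> ->].
Qed.

Lemma TA_generated f : f \in TA K 3 -> exists p, f = p \mPo gens.
Proof.
move=> fI; have [N [q hq]] := regular_denom_normal_form f.
pose d : {mpoly K[10]} := 'X_i1 * 'X_i3 * 'X_i4 * 'X_i7.
have dE w : d.@[w] = denom w by rewrite !mevalM !mevalXU.
pose dg := d \mPo gens.
have dgE : dg = tnth gens i1 * (tnth gens i3 * (tnth gens i4 * tnth gens i7)).
  by rewrite /dg !rmorphM /= !comp_mpolyXU -!tnth_nth !mulrA.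
have dg0 : dg != 0 by rewrite dgE !mulf_neq0 // gens_neq0 // !inE eqxx ?orbT.
(* Multiplying by dg once more makes both sides vanish where denom does. *)
have {hq} : dg ^+ N * f = q \mPo gens.
  apply: (mulfI dg0); rewrite -rmorphM /=; apply: gens_comp_funP => x y.
  rewrite !mevalM rmorphXn /= gens_comp_eval dE !mevalXU -/(denom _).
  have [->|dn] := eqVneq (denom (gval x y)) 0; first by rewrite !mul0r.
  by rewrite TA_eval // hq.
elim: N q => [|N IH] q; first by rewrite expr0 mul1r; exists q.
rewrite exprS -mulrA {1}dgE -!mulrA.
move=> /gens_comp_divides[|q1]; first by rewrite !inE eqxx.
move=> /gens_comp_divides[|q2]; first by rewrite !inE eqxx ?orbT.
move=> /gens_comp_divides[|q3]; first by rewrite !inE eqxx ?orbT.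
move=> /gens_comp_divides[|q4]; first by rewrite !inE eqxx ?orbT.
exact: IH.
Qed.

End Generation.

(** * The quotient algebra *)

Section Isomorphism.
Variable K : numFieldType.
Local Notation gens := (TA3_gens K).
Local Notation Q := {ideal_quot (TA3_ideal K)}.
Local Open Scope quotient_scope.

Lemma TA3_comp_eq0 (p : {mpoly K[10]}) :
  p \mPo gens = 0 <-> p \in TA3_ideal K.
Proof.
split=> [/relation_ideal_generated p_r|/asboolP[q ->]]; first exact/asboolP.
by rewrite rmorphM /= relation_comp0 mulr0.
Qed.

Lemma TA3_pi_eq (p q : {mpoly K[10]}) :
  p \mPo gens = q \mPo gens <-> \pi_Q p = \pi_Q q.
Proof.
split=> [e|/eqP].
  apply/eqP; rewrite -Quotient.idealrBE; apply/TA3_comp_eq0.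
  by rewrite rmorphB /= e subrr.
rewrite -Quotient.idealrBE => /TA3_comp_eq0/eqP.
by rewrite rmorphB /= subr_eq0 => /eqP.
Qed.

(** A chosen expression of an invariant as a polynomial in the generators. *)
Definition TA3_poly (f : TA_alg K 3) : {mpoly K[10]} :=
  sval (cid (TA_generated (valP f))).

Lemma TA3_polyP (f : TA_alg K 3) : val f = TA3_poly f \mPo gens.
Proof. exact: svalP (cid (TA_generated (valP f))). Qed.

(** The class of [TA3_poly f], which does not depend on the choice made. *)
Definition TA3_to_quot (f : TA_alg K 3) : Q := \pi_Q (TA3_poly f).

Lemma TA3_to_quotE f p : val f = p \mPo gens -> TA3_to_quot f = \pi_Q p.
Proof. by move=> e; apply/TA3_pi_eq; rewrite -TA3_polyP. Qed.

Lemma TA3_to_quot_linear : linear TA3_to_quot.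
Proof.
move=> c f g; rewrite (@TA3_to_quotE _ (c *: TA3_poly f + TA3_poly g)).
  by rewrite rmorphD /= pi_ideal_quotZ.
by rewrite linearP /= !TA3_polyP [RHS]linearP.
Qed.

Lemma TA3_to_quot_monoid_morphism : monoid_morphism TA3_to_quot.
Proof.
split=> [|f g].
  by rewrite (@TA3_to_quotE _ 1) ?rmorph1.
rewrite (@TA3_to_quotE _ (TA3_poly f * TA3_poly g)) ?rmorphM //=.
by rewrite !TA3_polyP.
Qed.

HB.instance Definition _ :=
  GRing.isLinear.Build K (TA_alg K 3) Q _ TA3_to_quot TA3_to_quot_linear.
HB.instance Definition _ :=
  GRing.isMonoidMorphism.Build (TA_alg K 3) Q TA3_to_quot
    TA3_to_quot_monoid_morphism.

Lemma TA3_to_quot_bij : bijective TA3_to_quot.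
Proof.
exists (fun z : Q => TAElem (gens_comp_in_TA (repr z))) => [f|z].
  apply: val_inj => /=; rewrite TA3_polyP; apply/TA3_pi_eq.
  by rewrite reprK.
by rewrite (@TA3_to_quotE _ (repr z)) ?reprK.
Qed.

End Isomorphism.

Theorem theorem3p6 (R : realType) :
  [/\ (forall f : {mpoly (R[i])[3 * 3 + 3 * 3]},
         f \in TA R[i] 3 <->
         exists p : {mpoly (R[i])[10]}, f = p \mPo TA3_gens R[i]),
      (forall p : {mpoly (R[i])[10]},
         p \mPo TA3_gens R[i] = 0 <-> p \in TA3_ideal R[i])
    & exists phi : {lrmorphism TA_alg R[i] 3 -> {ideal_quot (TA3_ideal R[i])}},
        bijective phi].
Proof.
split.
- by move=> f; split=> [/TA_generated|[p ->]] //; apply: gens_comp_in_TA.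
- exact: TA3_comp_eq0.
- by exists (@TA3_to_quot R[i]); apply: TA3_to_quot_bij.
Qed.
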